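(* Let $X$ be a reflexive Banach space and let $Z$ be a Hausdorff, locally convex topological vector space, let $C\subseteq Z$ be a convex, pointed cone with nonempty interior, and let $K$ be a nonempty, convex and closed subset of $X$. Let $D\subseteq K$ be a self segment-dense set in $K$ in the weak topology of $X$, and consider a mapping $F:K\to Z$ satisfying (i) $F$ is $C$-lower semicontinuous on $K$; (ii) $F$ is $C$-upper semicontinuous on $K\setminus D$; (iii) $F$ is $C$-convex on $D$; (iv) there exists $r>0$ such that for all $x\in K$ with $\|x\|\le r$ there exists $y_0\in D$ with $\|y_0\|<r$ such that $F(y_0)-F(x)\in -\operatorname{int} C\cup\{0\}$. Then there exists a weakly efficient point of $F$, i.e. there exists $x_0\in K$ such that $F(y)-F(x_0)\notin -\operatorname{int} C$ for all $y\in K$.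
   Context: All vector spaces are real. $\operatorname{int}$ denotes interior and $\operatorname{cl}$ closure. $-\operatorname{int}C\cup\{0\}$ means $(-\operatorname{int}C)\cup\{0\}$. A set $C\subseteq Z$ is a cone if $tc\in C$ for all $c\in C$ and $t\ge 0$; it is convex if $C+C=C$, and pointed if $C\cap(-C)=\{0\}$. Write $z_1\le z_2$ iff $z_2-z_1\in C$. Semicontinuity: a map $g:K\to Z$ is $C$-upper semicontinuous at $x\in K$ if for any neighborhood $V$ of $g(x)$ there exists a neighborhood $U$ of $x$ such that $g(u)\in V-C$ for all $u\in U\cap K$; $g$ is $C$-lower semicontinuous at $x$ if $-g$ is $C$-upper semicontinuous at $x$. Either property holds on a subset $S\subseteq K$ if it holds, for $g$ as a map on $K$, at every point of $S$. $C$-convexity: for a (not necessarily convex) set $D$, $g$ is $C$-convex on $D$ if for all $n\in\mathbb N$, $x_1,\dots,x_n\in D$ and $\lambda_1,\dots,\lambda_n\ge 0$ with $\sum_{i=1}^n\lambda_i=1$ such that $\sum_{i=1}^n\lambda_i x_i\in D$, one has $g\left(\sum_{i=1}^n\lambda_i x_i\right)\le\sum_{i=1}^n\lambda_i g(x_i)$. Self segment-dense set: let $U\subseteq V\subseteq X$ with $V$ convex. $U$ is self segment-dense in $V$ if $U$ is dense in $V$ (i.e. $V\subseteq\operatorname{cl}U$) and for all $x,y\in U$ the set $[x,y]\cap U$ is dense in $[x,y]$, where $[x,y]=\{x+t(y-x):t\in[0,1]\}$. ''Self segment-dense in the weak topology of $X$'' means that the closures in this definition are taken in the weak topology of $X$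.
   Formalization: Two hypotheses are added because the claim fails without them: Z ≠ {0}, and in (iv), for the same r, K contains a point with ‖x‖ ≤ r (otherwise (iv) is vacuous, e.g. K = D = [1,∞), F(x) = −x, r = 1/2). *)

(* Defs.v *)
From HB Require Import structures.
From mathcomp Require Import all_boot all_order all_algebra.
From mathcomp Require Import all_classical all_reals all_analysis.

Set Implicit Arguments.
Unset Strict Implicit.
Unset Printing Implicit Defensive.

Import Order.TTheory GRing.Theory Num.Theory.
Import numFieldNormedType.Exports.

Local Open Scope classical_set_scope.
Local Open Scope ring_scope.

Definition dual (R : realType) (X : normedModType R) : set (X -> R^o) :=
  [set f | linear f /\ continuous f].

Definition dual_norm (R : realType) (X : normedModType R) (f : X -> R^o) : R :=
  sup [set `|f x| | x in [set x : X | `|x| <= 1]].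

(* Only the values of [Phi] on [dual X] matter; [a *: f + g] is pointwise. *)
Definition bidual (R : realType) (X : normedModType R)
    (Phi : (X -> R^o) -> R) : Prop :=
  (forall (a : R) (f g : X -> R^o), dual f -> dual g ->
     Phi (a *: f + g) = a * Phi f + Phi g) /\
  (exists M : R, forall f : X -> R^o, dual f -> `|Phi f| <= M * dual_norm f).

(* Surjectivity of the canonical embedding into the bidual. *)
Definition reflexive_space (R : realType) (X : normedModType R) : Prop :=
  forall Phi : (X -> R^o) -> R, bidual Phi ->
    exists x : X, forall f : X -> R^o, dual f -> Phi f = f x.

Definition weak_space (R : realType) (X : normedModType R) : topologicalType :=
  sup_topology (fun f : {f : X -> R^o | dual f} =>
    Topological.on (initial_topology (sval f))).

Definition weak_closure (R : realType) (X : normedModType R) (A : set X) :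
    set X :=
  closure (A : set (weak_space X)).

Definition segment (R : realType) (X : lmodType R) (x y : X) : set X :=
  [set x + t *: (y - x) | t in [set t : R | 0 <= t <= 1]].

(* The topology enters through its closure operator [cl]. *)
Definition self_segment_dense (R : realType) (X : lmodType R)
    (cl : set X -> set X) (U V : set X) : Prop :=
  V `<=` cl U /\
  (forall x y, U x -> U y -> segment x y `<=` cl (segment x y `&` U)).

Definition cone (R : realType) (Z : lmodType R) (C : set Z) : Prop :=
  forall (t : R) (c : Z), 0 <= t -> C c -> C (t *: c).

Definition convex_cone (R : realType) (Z : lmodType R) (C : set Z) : Prop :=
  cone C /\ [set c + d | c in C & d in C] = C.

Definition opp_set (Z : zmodType) (A : set Z) : set Z := [set - a | a in A].

Definition pointed_cone (Z : zmodType) (C : set Z) : Prop :=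
  C `&` opp_set C = [set 0].

Definition cone_le (Z : zmodType) (C : set Z) (z1 z2 : Z) : Prop :=
  C (z2 - z1).

(* A map [K -> Z] is represented by a total function, of which only the values
   on [K] matter. *)
Definition cone_usc_at (R : realType) (X : topologicalType) (Z : tvsType R)
    (C : set Z) (K : set X) (g : X -> Z) (x : X) : Prop :=
  forall V : set Z, nbhs (g x) V ->
    exists2 U : set X, nbhs x U &
      forall u, (U `&` K) u -> [set v - c | v in V & c in C] (g u).

Definition cone_lsc_at (R : realType) (X : topologicalType) (Z : tvsType R)
    (C : set Z) (K : set X) (g : X -> Z) (x : X) : Prop :=
  cone_usc_at C K (fun u => - g u) x.

Definition cone_convex_on (R : realType) (X Z : lmodType R)
    (C : set Z) (D : set X) (g : X -> Z) : Prop :=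
  forall (n : nat) (x : 'I_n -> X) (l : 'I_n -> R),
    (forall i, D (x i)) -> (forall i, 0 <= l i) -> \sum_i l i = 1 ->
    D (\sum_i l i *: x i) ->
    cone_le C (g (\sum_i l i *: x i)) (\sum_i l i *: g (x i)).

Definition weakly_efficient (R : realType) (X : Type) (Z : tvsType R)
    (C : set Z) (K : set X) (F : X -> Z) (x0 : X) : Prop :=
  K x0 /\ forall y, K y -> ~ opp_set (interior C) (F y - F x0).

(* Main.v *)
(* Scalarize with the sublinear functional phi z = inf {t | t e - z \in C}, where e
   is interior to C: it is C-monotone and negative on - int C, so h = phi \o F is
   norm lower semicontinuous on K, upper semicontinuous off D and convex along
   segments whose endpoints and intermediate point lie in D, and every minimizer
   of h is weakly efficient.
   The norm closure of D is convex and weakly dense in K, hence contains K by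
   separation. Points outside D are points of upper semicontinuity, so convexity
   passes from D to K by approximating the endpoints in D and using lower
   semicontinuity at the intermediate point.
   The sublevel sets of h on K intersected with the ball of radius r are closed,
   convex and bounded: an ultrafilter refining them defines an element of the
   bidual, and the point representing it is a minimizer. Coercivity turns this
   into a global minimum, since a convex function minimal on a ball at a point of
   the open ball is minimal everywhere. *)

Require Import Defs.
From HB Require Import structures.
From mathcomp Require Import all_boot all_order all_algebra.
From mathcomp Require Import all_classical all_reals all_analysis.
From mathcomp Require Import lra.

Set Implicit Arguments.
Unset Strict Implicit.
Unset Printing Implicit Defensive.

Import Order.TTheory GRing.Theory Num.Theory.
Import numFieldNormedType.Exports.

Local Open Scope classical_set_scope.
Local Open Scope ring_scope.

(** * Hahn-Banach through minimal sublinear functionals *)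

(** Serves to prove subadditivity of functions defined pointwise as infima; [inf_leM] does the same
    for positive homogeneity. *)
Lemma inf_leD (R : realType) (A B E : set R) :
  A !=set0 -> B !=set0 -> has_lbound E ->
  (forall a b, A a -> B b -> exists2 c, E c & c <= a + b) ->
  inf E <= inf A + inf B.
Proof.
move=> A0 B0 Elb AB; rewrite -lerBlDr; apply: lb_le_inf => // a Aa.
rewrite lerBlDr addrC -lerBlDr; apply: lb_le_inf => // b Bb.
have [c Ec cab] := AB _ _ Aa Bb.
by rewrite lerBlDr addrC (le_trans _ cab)// ge_inf.
Qed.

Lemma inf_leM (R : realType) (t : R) (A E : set R) : 0 < t ->
  A !=set0 -> has_lbound E ->
  (forall a, A a -> exists2 c, E c & c <= t * a) ->
  inf E <= t * inf A.
Proof.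
move=> t0 A0 Elb AE; rewrite -ler_pdivrMl//; apply: lb_le_inf => // a Aa.
have [c Ec ca] := AE _ Aa.
by rewrite ler_pdivrMl// (le_trans _ ca)// ge_inf.
Qed.

(* The inequality for [t > 0] implies the equality for [t >= 0]. *)
Definition sublinear (R : realType) (X : lmodType R) (q : X -> R) :=
  (forall u v, q (u + v) <= q u + q v) /\
  (forall t v, 0 < t -> q (t *: v) <= t * q v).

Section sublinear.
Context {R : realType} {X : lmodType R}.
Implicit Types (p q : X -> R) (u v w : X) (t : R).

Lemma sublinear0 q : sublinear q -> q 0 = 0.
Proof.
move=> [qD qM]; have := qD 0 0; have := qM 2^-1 0; rewrite scaler0 addr0.
by have : 0 < 2^-1 :> R by []; lra.
Qed.

Lemma sublinearZ q t v : sublinear q -> 0 <= t -> q (t *: v) = t * q v.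
Proof.
move=> sq; rewrite le_eqVlt => /predU1P[<-|t0].
  by rewrite scale0r mul0r sublinear0.
case: sq => _ qM; apply/eqP; rewrite eq_le qM//=.
(* The reverse inequality is the hypothesis for the factor [t^-1] at [t *: v]. *)
by rewrite -ler_pdivlMl// -{1}(scalerK (lt0r_neq0 t0) v) qM// invr_gt0.
Qed.

Lemma sublinear_ge q v : sublinear q -> - q (- v) <= q v.
Proof.
by move=> sq; have := sq.1 v (- v); rewrite subrr (sublinear0 sq); lra.
Qed.

(** The infimum at [v] is finite, being bounded below by [- p (- v)]. It is subadditive because, of
    two members of a chain, the smaller one serves at both points. *)
Lemma sublinear_chain_inf p (A : set (X -> R)) : A !=set0 ->
  (forall q, A q -> sublinear q /\ forall v, q v <= p v) ->
  total_on A (fun q q' => forall v, q' v <= q v) ->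
  exists q, [/\ sublinear q, forall v, q v <= p v &
                forall q', A q' -> forall v, q v <= q' v].
Proof.
move=> [q0 Aq0] Ap Atot.
pose E v := [set q v | q in A].
have E0 v : E v !=set0 by exists (q0 v), q0.
have Elb v : has_lbound (E v).
  exists (- p (- v)) => _ [q Aq <-]; have [sq qp] := Ap _ Aq.
  by rewrite (le_trans _ (sublinear_ge v sq))// lerN2.
have Ele q v : A q -> inf (E v) <= q v by move=> Aq; apply: ge_inf => //; exists q.
exists (fun v => inf (E v)); split; last by move=> q' Aq' v; exact: Ele.
- split=> [u v|t v t0].
  + apply: inf_leD => // _ _ [q Aq <-] [q' Aq' <-].
    have [qq'|q'q] := Atot _ _ Aq Aq'.
    * exists (q' (u + v)); first by exists q'.
      by rewrite (le_trans ((Ap _ Aq').1.1 u v))// lerD2r.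
    * exists (q (u + v)); first by exists q.
      by rewrite (le_trans ((Ap _ Aq).1.1 u v))// lerD2l.
  + apply: inf_leM => // _ [q Aq <-]; exists (q (t *: v)); first by exists q.
    exact: (Ap _ Aq).1.2.
- by move=> v; rewrite (le_trans (Ele _ v Aq0))//; exact: (Ap _ Aq0).2.
Qed.

Lemma exists_minimal_sublinear p : sublinear p ->
  exists q, [/\ sublinear q, forall v, q v <= p v &
    forall q', sublinear q' -> (forall v, q' v <= q v) -> q' = q].
Proof.
move=> sp.
pose T := {q : X -> R | sublinear q /\ forall v, q v <= p v}.
(* The order is reversed, so that a maximal element for Zorn's lemma is a minimal function. *)
pose le (q q' : T) := `[< forall v, sval q' v <= sval q v >].
have [||||[q [sq qp]] qmin] := @Zorn T le.
- by move=> q; apply/asboolP.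
- move=> q1 q2 q3 /asboolP q12 /asboolP q23; apply/asboolP => v.
  exact: le_trans (q23 v) (q12 v).
- move=> [q1 P1] [q2 P2] /asboolP/= q12 /asboolP/= q21; apply: eq_exist.
  by apply/funext => v; apply/eqP; rewrite eq_le q12 q21.
- move=> A Atot; have [->|/set0P[q0 Aq0]] := eqVneq A set0.
    by exists (exist _ p (conj sp (fun v => lexx (p v)))).
  have [|||q [sq qp qA]] :=
    @sublinear_chain_inf p (sval @` A).
  + by exists (sval q0), q0.
  + by move=> _ [q _ <-]; exact: (svalP q).
  + move=> _ _ [q2 Aq2 <-] [q3 Aq3 <-].
    by have [/asboolP|/asboolP] := Atot _ _ Aq2 Aq3; [left|right].
  + exists (exist _ q (conj sq qp)) => s As; apply/asboolP => /=.
    by apply: qA; exists s.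
exists q; split=> // q' sq' q'q.
have q'p v : q' v <= p v by exact: le_trans (q'q v) (qp v).
suff /(congr1 sval) : exist _ q' (conj sq' q'p) = exist _ q (conj sq qp) :> T by [].
by apply: qmin; apply/asboolP.
Qed.

(** The function sending [u] to the infimum of [q (u + l *: w) - l * q w] over [l >= 0] is sublinear
    and, by [l = 0], at most [q], hence equal to [q]; then [l = 1] gives
    [q v + q w <= q (v + w)]. *)
Lemma minimal_sublinear_additive q : sublinear q ->
  (forall q', sublinear q' -> (forall v, q' v <= q v) -> q' = q) ->
  forall v w, q (v + w) = q v + q w.
Proof.
move=> sq qmin v w; apply/eqP; rewrite eq_le sq.1/=.
pose E v := [set q (v + l *: w) - l * q w | l in [set l | 0 <= l]].
have E0 u : E u !=set0 by exists (q (u + 0 *: w) - 0 * q w), 0 => /=.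
have Elb u : has_lbound (E u).
  exists (- q (- u)) => _ [l /= l0 <-]; rewrite -(sublinearZ w sq l0).
  have := sq.1 (u + l *: w) (- u).
  by rewrite addrAC subrr add0r; lra.
have Ele u l : 0 <= l -> inf (E u) <= q (u + l *: w) - l * q w.
  by move=> l0; apply: ge_inf => //; exists l.
suff qE : (fun u => inf (E u)) = q.
  have := Ele v 1 ler01; rewrite scale1r mul1r => Ev.
  by have := congr1 (fun f => f v) qE => /= Eqv; lra.
apply: qmin => [|u]; last by have := Ele u 0 (lexx _); rewrite scale0r addr0; lra.
split=> [u1 u2|t u t0].
- apply: inf_leD => // _ _ [l1 /= l10 <-] [l2 /= l20 <-].
  exists (q (u1 + u2 + (l1 + l2) *: w) - (l1 + l2) * q w).
    by exists (l1 + l2) => //=; rewrite addr_ge0.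
  by rewrite scalerDl addrACA; have := sq.1 (u1 + l1 *: w) (u2 + l2 *: w); lra.
- apply: inf_leM => // _ [l /= l0 <-].
  exists (q (t *: u + (t * l) *: w) - (t * l) * q w).
    by exists (t * l) => //=; rewrite mulr_ge0// ltW.
  by rewrite -scalerA -scalerDr (sublinearZ _ sq (ltW t0)) mulrBr mulrA.
Qed.

(* A minimal sublinear function is linear. *)
Theorem hahn_banach p : sublinear p ->
  exists f : X -> R^o, linear f /\ forall v, f v <= p v.
Proof.
move=> /exists_minimal_sublinear[q [sq qp qmin]]; exists q; split=> // a u v.
have qD := minimal_sublinear_additive sq qmin.
have qN w : q (- w) = - q w.
  by have := qD w (- w); rewrite subrr (sublinear0 sq); lra.
rewrite qD; congr (_ + _); have [a0|a0] := leP 0 a; first exact: sublinearZ.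
rewrite -[a]opprK scaleNr qN (sublinearZ _ sq) ?mulNr ?opprK//.
by rewrite oppr_ge0 ltW.
Qed.

End sublinear.

(** * Separation and reflexivity in normed spaces *)

Lemma segment_combE (R : realType) (X : lmodType R) (x y : X) (t : R) :
  x + t *: (y - x) = (1 - t) *: x + t *: y.
Proof. by rewrite scalerBl scale1r scalerBr addrA addrAC. Qed.

(** The library weights the first point by the parameter, whence the swapped endpoints in both
    directions. *)
Lemma convex_setP (R : realType) (X : lmodType R) (A : set X) :
  convex_set (A : set (convex_lmodType X)) <->
  forall (x y : X) (t : R), A x -> A y -> 0 <= t -> t <= 1 ->
    A (x + t *: (y - x)).
Proof.
split=> [Acvx x y t Ax Ay t0 t1|Acvx x y l /[!inE] Ax Ay].
- have := Acvx y x (Itv01 t0 t1) (mem_set Ay) (mem_set Ax) => /set_mem.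
  by rewrite segment_combE addrC; exact.
- have := Acvx y x l%:num Ay Ax (ge0 l) (le1 l).
  by rewrite segment_combE addrC; exact.
Qed.

Section dual.
Context {R : realType} {X : normedModType R}.
Implicit Types (f : X -> R^o) (x y : X) (S : set X).

Lemma dualB f x y : dual f -> f (x - y) = f x - f y.
Proof.
by move=> [fl _]; rewrite addrC -scaleN1r fl scaleN1r addrC.
Qed.

Lemma dual0 f : dual f -> f 0 = 0.
Proof. by move=> df; rewrite -(subrr 0) dualB// subrr. Qed.

Lemma dualZ f a x : dual f -> f (a *: x) = a * f x.
Proof. by move=> df; have := df.1 a x 0; rewrite (dual0 df) !addr0. Qed.

(** The one-sided bound, taken at [x - y] and at [y - x], makes [f] 1-Lipschitz. *)
Lemma linear_le_norm_dual f : linear f -> (forall v, f v <= `|v|) -> dual f.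
Proof.
move=> fl fle; split=> // x.
have fB u v : f (u - v) = f u - f v.
  by rewrite addrC -scaleN1r fl scaleN1r addrC.
apply/cvgrPdist_lt => e e0; near=> y.
suff fxy : `|f x - f y| <= `|x - y|.
  apply: le_lt_trans fxy _; near: y; exact: cvgr_dist_lt.
have := fle (y - x); have := fle (x - y); rewrite distrC !fB distrC => ? ?.
by rewrite ler_norml; apply/andP; split; lra.
Unshelve. all: by end_near. Qed.

Lemma dual_bounded f : dual f ->
  exists2 M, 0 < M & forall x, `|x| <= 1 -> `|f x| <= M.
Proof.
move=> df.
have /cvgrPdist_lt /(_ 1 ltr01) := df.2 0.
rewrite (dual0 df) => /nbhs_ballP[d /= d0 dP].
(* Scaling by [d / 2] sends the closed unit ball into the ball of radius [d], where [f] is below 1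
   in absolute value. *)
exists (2 / d); first by rewrite divr_gt0.
move=> x x1.
have : ball 0 d ((d / 2) *: x).
  rewrite -ball_normE /= sub0r normrN normrZ gtr0_norm ?divr_gt0//.
  by have := normr_ge0 x; nra.
move=> /dP /=; rewrite sub0r normrN dualZ// normrM gtr0_norm ?divr_gt0// => h.
rewrite -[_ / _]mulr1 -ler_pdivrMl ?divr_gt0// invf_div.
exact: ltW.
Qed.

Lemma ler_dual_norm f x : dual f -> `|f x| <= dual_norm f * `|x|.
Proof.
move=> df; have [M _ fM] := dual_bounded df.
have [->|x0] := eqVneq x 0; first by rewrite dual0// !normr0 mulr0.
rewrite -ler_pdivrMr ?normr_gt0//; apply: ub_le_sup.
  by exists M => _ [z z1 <-]; exact: fM.
exists (`|x|^-1 *: x) => /=.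
  by rewrite normrZ normfV normr_id mulVf ?normr_eq0.
by rewrite dualZ// normrM normfV normr_id mulrC.
Qed.

Lemma dual_norm_ge0 f : dual f -> 0 <= dual_norm f.
Proof.
move=> df; have [M _ fM] := dual_bounded df; apply: ub_le_sup.
  by exists M => _ [z z1 <-]; exact: fM.
by exists 0; [rewrite /= normr0|rewrite dual0// normr0].
Qed.

(** The weak topology enters the proof only through this consequence, one functional at a time. *)
Lemma weak_closure_dual (A : set X) f x e : dual f -> 0 < e ->
  weak_closure A x -> exists2 a, A a & `|f a - f x| < e.
Proof.
move=> df e0 clx.
have fx : nbhs (x : initial_topology f) [set z : X | `|f z - f x| < e].
  apply: (@initial_continuous X R^o f x [set z | `|z - f x| < e]).
  have := @nbhsx_ballx R R^o (f x) e e0.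
  by apply: filterS => z; rewrite -ball_normE /= distrC.
have /cvg_sup /(_ (exist _ f df) _ fx) :
  nbhs (x : weak_space X) --> (x : weak_space X) by [].
by move=> /clx[a [Aa /= ae]]; exists a.
Qed.

(* [p v = inf (|v + l (s - x)| - l d)] over [l >= 0] and [s] in [S] is sublinear
   with [p v <= |v|] and [p (x - s) <= - d]. *)
Lemma separation S x : convex_set (S : set (convex_lmodType X)) -> closed S ->
  ~ S x -> exists2 f, dual f & exists2 d, 0 < d & forall s, S s -> f x + d <= f s.
Proof.
move=> /convex_setP Scvx Scl Sx.
have [->|/set0P[s0 Ss0]] := eqVneq S set0.
  exists (fun=> 0); last by exists 1.
  by split=> [a u v|]; [rewrite scaler0 addr0|exact: cst_continuous].
have [d d0 dS] : exists2 d, 0 < d & forall s, S s -> d <= `|s - x|.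
  have : nbhs x (~` S) by apply: open_nbhs_nbhs; split=> //; rewrite openC.
  move=> /nbhs_ballP[d /= d0 dS]; exists d => // s Ss.
  rewrite leNgt; apply/negP => sx; apply: (dS s) => //.
  by rewrite -ball_normE /= distrC.
pose E v := [set `|v + l *: (s - x)| - l * d | l in [set l | 0 <= l] & s in S].
pose p v := inf (E v).
have E0 v : E v !=set0.
  exists (`|v + 0 *: (s0 - x)| - 0 * d).
  by exists 0; [exact: lexx|exists s0].
have Elb v : has_lbound (E v).
  exists (- `|v|) => _ [l /= l0 [s Ss <-]].
  have := ler_normB (v + l *: (s - x)) v.
  rewrite addrAC subrr add0r normrZ ger0_norm//.
  by have := dS _ Ss; nra.
have Ele v l s : 0 <= l -> S s -> p v <= `|v + l *: (s - x)| - l * d.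
  by move=> l0 Ss; apply: ge_inf => //; exists l => //; exists s.
have sp : sublinear p.
  split=> [u v|t v t0].
  - apply: inf_leD => // _ _ [l1 /= l10 [s1 Ss1 <-]] [l2 /= l20 [s2 Ss2 <-]].
    (* The weighted mean used below divides by [l1 + l2]; if this is 0, [s1] will do. *)
    have [l12|l12] := eqVneq (l1 + l2) 0.
      have [-> ->] : l1 = 0 /\ l2 = 0 by split; lra.
      exists (`|u + v|).
        by exists 0 => //=; exists s1 => //; rewrite scale0r addr0 mul0r subr0.
      by rewrite !scale0r !addr0 !mul0r !subr0 ler_normD.
    have l12' : 0 < l1 + l2 by rewrite lt_neqAle eq_sym l12 addr_ge0.
    have [t0 t1] : 0 <= l2 / (l1 + l2) /\ l2 / (l1 + l2) <= 1.
      by rewrite divr_ge0 ?(ltW l12')// ler_pdivrMr// mul1r lerDr.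
    (* The mean of [s1] and [s2] with weights proportional to [l1] and [l2]: its displacement from
       [x], times [l1 + l2], is the sum of the two given displacements. *)
    have Ss := Scvx _ _ _ Ss1 Ss2 t0 t1.
    set s := s1 + _ in Ss.
    exists (`|u + v + (l1 + l2) *: (s - x)| - (l1 + l2) * d).
      by exists (l1 + l2) => //=; [rewrite addr_ge0|exists s].
    have -> : (l1 + l2) *: (s - x) = l1 *: (s1 - x) + l2 *: (s2 - x).
      rewrite /s addrAC scalerDr scalerA mulrCA mulfV// mulr1 scalerDl -addrA.
      rewrite -scalerDr; congr (_ + _ *: _).
      by rewrite [LHS]addrC subrKA.
    rewrite addrACA.
    by have := ler_normD (u + l1 *: (s1 - x)) (v + l2 *: (s2 - x)); lra.
  - apply: inf_leM => // _ [l /= l0 [s Ss <-]].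
    exists (`|t *: v + (t * l) *: (s - x)| - t * l * d).
      by exists (t * l); [rewrite /= mulr_ge0// ltW|exists s].
    by rewrite -scalerA -scalerDr normrZ gtr0_norm// mulrBr mulrA.
have [f [fl fp]] := hahn_banach sp.
have df : dual f.
  apply: linear_le_norm_dual => // v; apply: le_trans (fp v) _.
  by have := Ele v 0 s0 (lexx _) Ss0; rewrite scale0r addr0 mul0r subr0.
exists f => //; exists d => // s Ss.
have := Ele (x - s) 1 s ler01 Ss.
rewrite scale1r mul1r subrKA subrr normr0 sub0r.
by have := fp (x - s); rewrite dualB//; lra.
Qed.

Lemma dual_separates x y : x <> y -> exists2 f, dual f & f (y - x) != 0.
Proof.
move=> xy.
have [|||f df [d d0 /(_ x erefl) fxy]] := @separation [set x] y.
- by apply/convex_setP => _ _ t -> -> _ _ /=; rewrite subrr scaler0 addr0.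
- exact/accessible_closed_set1/hausdorff_accessible/norm_hausdorff.
- by move=> /= /esym.
- by exists f => //; rewrite dualB// lt_eqF//; lra.
Qed.

End dual.

Lemma fmap_ultra (T U : Type) (f : T -> U) (G : set_system T) :
  UltraFilter G -> UltraFilter (fmap f G).
Proof.
move=> GU; split; first exact: fmap_proper_filter.
move=> H HP GH; apply/seteqP; split=> // A HA.
have [//|GA] := in_ultra_setVsetC (f @^-1` A) GU.
have HAC : H (~` A) by exact: GH.
by have [x []] := filter_ex (filterI HA HAC).
Qed.

(** This stands in for weak compactness of the ball. Along [G] each functional takes values in a
    compact interval, hence converges; the limits form an element of the bidual, represented by [x].
    A functional strictly separating [x] from a member [S] of [G] could not converge to its value at
    [x]. *)
Lemma reflexive_ultra_point (R : realType) (X : normedModType R)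
  (G : set_system X) (r : R) : reflexive_space X -> UltraFilter G ->
  G [set x | `|x| <= r] ->
  exists x : X, forall S : set X, convex_set (S : set (convex_lmodType X)) ->
    closed S -> G S -> S x.
Proof.
move=> Xr GU Gr.
pose Phi (f : X -> R^o) : R^o := lim (f @ G).
have fPhi f : dual f -> f @ G --> Phi f.
  move=> df.
  have : compact `[- (dual_norm f * r), dual_norm f * r]%classic.
    exact: segment_compact.
  rewrite compact_ultra => /(_ (f @ G) (fmap_ultra _ GU))[|l [_ fl]]; last first.
    by apply/cvg_ex; exists l.
  rewrite /fmap /=; apply: filterS Gr => x /= xr.
  rewrite in_itv /= -ler_norml (le_trans (ler_dual_norm _ df))//.
  by rewrite ler_wpM2l// dual_norm_ge0.
have [|x xPhi] := Xr Phi.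
  split=> [a f g df dg|].
  - apply: (@cvg_lim R^o) => //.
    by apply: cvgD; [apply: (@cvgZl_tmp R R^o); exact: fPhi|exact: fPhi].
  - exists r => f df; apply/ler_addgt0Pr => e e0.
    have [y [yr ye]] : exists y, `|y| <= r /\ `|Phi f - f y| < e.
      apply: (@filter_ex _ G); near=> y; split; near: y; first exact: Gr.
      by have /cvgrPdist_lt /(_ _ e0) := fPhi f df.
    have := ler_dual_norm y df; have := dual_norm_ge0 df.
    have := ler_normD (f y) (Phi f - f y); rewrite addrC subrK.
    by move: (normr_ge0 y) => ? ? ? ?; nra.
exists x => S Scvx Scl GS; apply: contrapT => Sx.
have [f df [d d0 fS]] := separation Scvx Scl Sx.
have [y [Sy]] : exists y, S y /\ `|f x - f y| < d.
  apply: (@filter_ex _ G); near=> y; split; near: y; first exact: GS.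
  by rewrite -xPhi//; have /cvgrPdist_lt /(_ _ d0) := fPhi f df.
by have := fS _ Sy; rewrite ltr_norml => ? /andP[]; lra.
Unshelve. all: by end_near. Qed.

(** * The scalar minimization problem *)

Section scalar.
Context {R : realType} {X : normedModType R}.
Implicit Types (x y u v : X) (K D : set X) (h : X -> R).

Lemma closure_normP D x :
  closure D x <-> forall e, 0 < e -> exists2 a, D a & `|x - a| < e.
Proof.
split=> [Dx e e0|Dx B /nbhs_ballP[e /= e0 xB]].
- have [a [Da]] := Dx _ (nbhsx_ballx x e e0).
  by rewrite -ball_normE => xa; exists a.
- have [a Da xa] := Dx _ e0; exists a; split=> //; apply: xB.
  by rewrite -ball_normE.
Qed.

Lemma segment_dist x y u v t e : 0 <= t -> t <= 1 ->
  `|x - u| < e -> `|y - v| < e ->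
  `|(x + t *: (y - x)) - (u + t *: (v - u))| < e.
Proof.
move=> t0 t1 xu yv.
have -> : (x + t *: (y - x)) - (u + t *: (v - u))
    = (1 - t) *: (x - u) + t *: (y - v).
  by rewrite !segment_combE !scalerBr opprD addrACA.
apply: le_lt_trans (ler_normD _ _) _.
rewrite !normrZ !ger0_norm ?subr_ge0//.
(* The weight [t] must be positive for the second strict inequality to count; at [t = 0] the first
   one suffices. *)
have [->|t0'] := eqVneq t 0; first by rewrite subr0 mul1r mul0r addr0.
have : 0 < t by rewrite lt_neqAle eq_sym t0'.
by move=> ?; nra.
Qed.

Lemma segment_param_dist x y s t :
  `|(x + t *: (y - x)) - (x + s *: (y - x))| = `|s - t| * `|y - x|.
Proof. by rewrite opprD addrACA subrr add0r -scalerBl normrZ distrC. Qed.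

(* A functional separating the endpoints is a coordinate on the segment, so weak
   density there is density of the parameters. *)
Lemma weakly_dense_segment D x y t e :
  segment x y `<=` weak_closure (segment x y `&` D) -> D x ->
  0 <= t -> t <= 1 -> 0 < e ->
  exists s, [/\ 0 <= s, s <= 1, `|s - t| < e & D (x + s *: (y - x))].
Proof.
move=> xyD Dx t0 t1 e0; have [<-|/eqP xy] := eqVneq x y.
  by exists t; rewrite !subrr normr0 scaler0 addr0.
have [f df fxy] := dual_separates xy.
have /xyD : segment x y (x + t *: (y - x)) by exists t => //=; rewrite t0 t1.
(* On the segment [f] multiplies parameter differences by [f (y - x)], so the tolerance is scaled
   accordingly. *)
have e'0 : 0 < e * `|f (y - x)| by rewrite mulr_gt0// normr_gt0.
move=> /(weak_closure_dual df e'0)[_ [[s /= /andP[s0 s1] <-] Ds]].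
rewrite -dualB//.
have -> : (x + s *: (y - x)) - (x + t *: (y - x)) = (s - t) *: (y - x).
  by rewrite opprD addrACA subrr add0r -scalerBl.
by rewrite dualZ// normrM ltr_pM2r ?normr_gt0// => st; exists s.
Qed.

Lemma self_segment_dense_param D K x y t e :
  self_segment_dense (@weak_closure R X) D K -> D x -> D y ->
  0 <= t -> t <= 1 -> 0 < e ->
  exists s, [/\ 0 <= s, s <= 1, `|s - t| < e & D (x + s *: (y - x))].
Proof.
by move=> [_ Dseg] Dx Dy; apply: weakly_dense_segment => //; exact: Dseg.
Qed.

Lemma self_segment_dense_closure D K :
  self_segment_dense (@weak_closure R X) D K -> K `<=` closure D.
Proof.
move=> DK x Kx; apply: contrapT => Dx.
(* Endpoints are approximated in [D] within [e / 2], then the parameter is adjusted to reach a point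
   of [D], at a cost below [e / 2]. The 1 added to the denominator covers coinciding endpoints. *)
have cvxD : convex_set (closure D : set (convex_lmodType X)).
  apply/convex_setP => u v t /closure_normP Du /closure_normP Dv t0 t1.
  apply/closure_normP => e e0; have e20 : 0 < e / 2 by rewrite divr_gt0.
  have [u' Du' uu'] := Du _ e20; have [v' Dv' vv'] := Dv _ e20.
  have c0 : 0 < `|v' - u'| + 1 by rewrite ltr_wpDl.
  have [|s [s0 s1 st Ds]] :=
    @self_segment_dense_param D K u' v' t (e / 2 / (`|v' - u'| + 1)) DK Du' Dv' t0 t1.
    by rewrite divr_gt0.
  exists (u' + s *: (v' - u')) => //.
  have := segment_dist t0 t1 uu' vv'.
  have := segment_param_dist u' v' s t.
  move: st; rewrite ltr_pdivlMr// => st.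
  have := ler_distD (u' + t *: (v' - u')) (u + t *: (v - u)) (u' + s *: (v' - u')).
  by have := normr_ge0 (s - t); lra.
have [f df [d d0 fD]] := separation cvxD (@closed_closure _ _) Dx.
have [a Da] := weak_closure_dual df d0 (DK.1 _ Kx).
by have := fD _ (subset_closure Da); rewrite ltr_norml => ? /andP[]; lra.
Qed.

Lemma convex_of_convex_on_dense D K h :
  D `<=` K -> convex_set (K : set (convex_lmodType X)) ->
  self_segment_dense (@weak_closure R X) D K ->
  (forall x, K x -> forall e, 0 < e -> \forall u \near x, K u -> h x < h u + e) ->
  (forall x, (K `\` D) x ->
    forall e, 0 < e -> \forall u \near x, K u -> h u < h x + e) ->
  (forall x y t, D x -> D y -> 0 <= t -> t <= 1 -> D (x + t *: (y - x)) ->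
    h (x + t *: (y - x)) <= h x + t * (h y - h x)) ->
  forall x y t, K x -> K y -> 0 <= t -> t <= 1 ->
    h (x + t *: (y - x)) <= h x + t * (h y - h x).
Proof.
move=> DK /convex_setP Kcvx Ddense hlsc husc hD.
have lsc x e : K x -> 0 < e ->
    exists2 d, 0 < d & forall u, K u -> `|x - u| < d -> h x < h u + e.
  move=> Kx e0; have /nbhs_ballP[d /= d0 dP] := hlsc _ Kx _ e0.
  by exists d => // u Ku xu; apply: dP => //; rewrite -ball_normE.
(* The intermediate point need not lie in [D]: it is approached by points of [D] on the same
   segment, and lower semicontinuity at the limit preserves the inequality. *)
have hDseg x y t : D x -> D y -> 0 <= t -> t <= 1 ->
    h (x + t *: (y - x)) <= h x + t * (h y - h x).
  move=> Dx Dy t0 t1; apply/ler_addgt0Pr => e e0.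
  have e20 : 0 < e / 2 by rewrite divr_gt0.
  have [d d0 dP] := lsc _ _ (Kcvx _ _ _ (DK _ Dx) (DK _ Dy) t0 t1) e20.
  have c0 : 0 < `|y - x| + 1 by rewrite ltr_wpDl.
  have b0 : 0 < `|h y - h x| + 1 by rewrite ltr_wpDl.
  (* The first bound keeps the new point within the radius [d] of lower semicontinuity, the second
     changes the chord value by less than [e / 2]. *)
  have [|s [s0 s1 st Ds]] := @self_segment_dense_param D K x y t
      (Num.min (d / (`|y - x| + 1)) (e / 2 / (`|h y - h x| + 1))) Ddense Dx Dy t0 t1.
    by rewrite lt_min !divr_gt0.
  move: st; rewrite lt_min !ltr_pdivlMr// => /andP[std ste].
  have := dP _ (DK _ Ds); rewrite segment_param_dist => /(_ _)/wrap[|].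
    by have := normr_ge0 (s - t); lra.
  have := hD _ _ _ Dx Dy s0 s1 Ds.
  have := ler_norm ((s - t) * (h y - h x)); rewrite normrM mulrBl.
  by have := normr_ge0 (s - t); lra.
(* A point of [D] approximates itself; at any other point of [K], upper semicontinuity controls [h]
   on nearby points of [D]. *)
have appr x e : K x -> 0 < e -> exists u, [/\ D u, `|x - u| < e & h u < h x + e].
  move=> Kx e0; have [Dx|Dx] := pselect (D x).
    by exists x; rewrite subrr normr0 ltrDl.
  have /nbhs_ballP[d /= d0 dP] := husc _ (conj Kx Dx) _ e0.
  have /closure_normP /(_ (Num.min d e))[|u Du] :=
    self_segment_dense_closure Ddense Kx; first by rewrite lt_min d0.
  rewrite lt_min => /andP[ud ue]; exists u; split=> //.
  by apply: dP; [rewrite -ball_normE|exact: DK].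
move=> x y t Kx Ky t0 t1; apply/ler_addgt0Pr => e e0.
have e20 : 0 < e / 2 by rewrite divr_gt0.
have [d d0 dP] := lsc _ _ (Kcvx _ _ _ Kx Ky t0 t1) e20.
have m0 : 0 < Num.min d (e / 2) by rewrite lt_min d0.
have [u [Du xu hu]] := appr _ _ Kx m0; have [v [Dv yv hv]] := appr _ _ Ky m0.
have := dP _ (Kcvx _ _ _ (DK _ Du) (DK _ Dv) t0 t1).
have := segment_dist t0 t1 xu yv; rewrite lt_min => /andP[uvd _] /(_ uvd).
have := hDseg _ _ _ Du Dv t0 t1.
have : h u < h x + e / 2 by rewrite (lt_le_trans hu)// lerD2l ge_min lexx orbT.
have : h v < h y + e / 2 by rewrite (lt_le_trans hv)// lerD2l ge_min lexx orbT.
by nra.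
Qed.

(** The sublevel sets in the ball are nested, so the nonempty ones generate a proper filter. The
    point attached to a finer ultrafilter lies in all of them, in particular in the one at level
    [h y] for every competitor [y]. *)
Lemma reflexive_exists_min K h r : reflexive_space X ->
  convex_set (K : set (convex_lmodType X)) -> closed K ->
  (forall x, K x -> forall e, 0 < e -> \forall u \near x, K u -> h x < h u + e) ->
  (forall x y t, K x -> K y -> 0 <= t -> t <= 1 ->
    h (x + t *: (y - x)) <= h x + t * (h y - h x)) ->
  (exists x, K x /\ `|x| <= r) ->
  exists x, [/\ K x, `|x| <= r & forall y, K y -> `|y| <= r -> h x <= h y].
Proof.
move=> Xr /convex_setP Kcvx Kcl hlsc hcvx [x1 [Kx1 x1r]].
pose S t := [set x | [/\ K x, `|x| <= r & h x <= t]].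
have Sle s t : s <= t -> S s `<=` S t.
  by move=> st x [Kx xr hx]; split=> //; exact: le_trans st.
have Sh x : K x -> `|x| <= r -> S (h x) x by [].
have Scvx t : convex_set (S t : set (convex_lmodType X)).
  apply/convex_setP => x y l [Kx xr hx] [Ky yr hy] l0 l1; split.
  - exact: Kcvx.
  - rewrite segment_combE (le_trans (ler_normD _ _))// !normrZ.
    by rewrite !ger0_norm ?subr_ge0//; nra.
  - by apply: le_trans (hcvx _ _ _ Kx Ky l0 l1) _; nra.
have Scl t : closed (S t).
  move=> x Sx; have Kx : K x.
    by apply: Kcl => B /Sx[y [[Ky _ _] By]]; exists y.
  split=> //; apply/ler_addgt0Pr => e e0.
  - move/closure_normP : Sx => /(_ _ e0)[y [Ky yr hy] xy].
    by have := ler_normD (x - y) y; rewrite subrK; lra.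
  - by have [y [[Ky yr hy] /(_ Ky)]] := Sx _ (hlsc _ Kx _ e0); lra.
(* Admitting only levels with a nonempty sublevel set makes the filter proper before [h] is known to
   be bounded below. *)
pose F := filter_from [set t | S t !=set0] S.
have FF : ProperFilter F.
  apply: filter_from_proper => //; apply: filter_from_filter.
    by exists (h x1), x1.
  move=> s t [x Sx] [y Sy].
  exists (Num.min s t); last by move=> z Sz; split; apply: Sle Sz; rewrite ge_min lexx ?orbT.
  by rewrite /Num.min/=; case: ifPn => _; [exists x|exists y].
have [G [GU FG]] := ultraFilterLemma FF.
have FS y : K y -> `|y| <= r -> F (S (h y)).
  by move=> Ky yr; exists (h y) => //; exists y; exact: Sh.
have [|x xS] := @reflexive_ultra_point R X G r Xr GU.
  by apply: FG; exists (h x1); [exists x1|move=> x []].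
have xSh y : K y -> `|y| <= r -> S (h y) x.
  by move=> Ky yr; apply: xS => //; apply: FG; exact: FS.
have [Kx xr _] := xSh _ Kx1 x1r.
by exists x; split=> // y Ky yr; have [] := xSh _ Ky yr.
Qed.

End scalar.

(** * Scalarization *)

Section topological_lmodule.
Context {R : realType} {Z : tvsType R} {T : Type} {F : set_system T}.
Context {FF : Filter F}.

Lemma tvs_cvgB (f g : T -> Z) (a b : Z) :
  f @ F --> a -> g @ F --> b -> (f x - g x) @[x --> F] --> a - b.
Proof.
apply: (@continuous2_cvg _ _ _ _ _ _ _ _ (fun x y : Z => x - y)).
exact: (@sub_continuous Z (a, b)).
Qed.

Lemma tvs_cvgZ (f : T -> R^o) (g : T -> Z) (a : R^o) (b : Z) :
  f @ F --> a -> g @ F --> b -> (f x *: g x) @[x --> F] --> a *: b.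
Proof.
apply: (@continuous2_cvg _ _ _ _ _ _ _ _ (fun (x : R^o) (y : Z) => x *: y)).
exact: (@scale_continuous _ Z (a, b)).
Qed.

End topological_lmodule.

Section gerstewitz.
Context {R : realType} {Z : tvsType R} (C : set Z) (e : Z).
Context (Z_nontrivial : exists z : Z, z <> 0) (C_convex : convex_cone C)
  (C_pointed : pointed_cone C) (e_int : interior C e).

Let CZ t c : 0 <= t -> C c -> C (t *: c). Proof. exact: C_convex.1. Qed.

Let CD c d : C c -> C d -> C (c + d).
Proof. by move=> Cc Cd; rewrite -C_convex.2; exists c => //; exists d. Qed.

Let C0 : C 0.
Proof. by rewrite -(scale0r e); apply: CZ => //; exact: interior_subset. Qed.

Lemma interior_absorbing c z : interior C c ->
  exists2 d : R, 0 < d & C (c - d *: z).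
Proof.
move=> Cc.
have cont : (fun d : R^o => c - d *: z) @ (0 : R^o) --> c.
  rewrite -[X in _ --> X]subr0 -(scale0r z).
  by apply: tvs_cvgB; [exact: cvg_cst|apply: tvs_cvgZ; [exact: cvg_id|exact: cvg_cst]].
have /nbhs_ballP[d /= d0 dP] := cont _ Cc.
exists (d / 2); first by rewrite divr_gt0.
by apply: dP; rewrite -ball_normE /= sub0r normrN gtr0_norm ?divr_gt0//; lra.
Qed.

(* Otherwise [e = 0] by pointedness, so [0] is interior to [C] and [C] is the whole
   space, which is not pointed. *)
Lemma opp_order_unit_notin : ~ C (- e).
Proof.
move=> CNe.
have e0 : e = 0.
  have : (C `&` opp_set C) e by split; [exact: interior_subset|exists (- e); rewrite ?opprK].
  by rewrite C_pointed.
case: Z_nontrivial => z; apply.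
have C0i : interior C 0 by rewrite -e0.
have [d1 d10] := interior_absorbing z C0i; rewrite sub0r => h1.
have [d2 d20] := interior_absorbing (- z) C0i; rewrite sub0r scalerN opprK => h2.
have h1' : C (- z).
  by have := CZ (ltW (_ : 0 < d1^-1)) h1; rewrite scalerN scalerK ?lt0r_neq0//; apply; rewrite invr_gt0.
have h2' : C z.
  by have := CZ (ltW (_ : 0 < d2^-1)) h2; rewrite scalerK ?lt0r_neq0//; apply; rewrite invr_gt0.
have : (C `&` opp_set C) z by split=> //; exists (- z); rewrite ?opprK.
by rewrite C_pointed.
Qed.

(** For the nonnegative orthant and the all-ones vector [e] this is the largest coordinate of
    [z]. *)
Definition gerstewitz (z : Z) : R := inf [set t | C (t *: e - z)].

Lemma gerstewitz_nonempty z : [set t : R | C (t *: e - z)] !=set0.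
Proof.
have [d d0 Cd] := interior_absorbing z e_int.
exists d^-1 => /=.
have -> : d^-1 *: e - z = d^-1 *: (e - d *: z).
  by rewrite scalerBr scalerK ?lt0r_neq0.
by apply: CZ => //; rewrite invr_ge0 ltW.
Qed.

(** If [t *: e - z] and [t0 *: e + z] lie in [C], so does their sum [(t + t0) *: e]; were [t + t0]
    negative, [C] would contain [- e]. *)
Lemma gerstewitz_lbound z : has_lbound [set t : R | C (t *: e - z)].
Proof.
have [t0 /= Ct0] := gerstewitz_nonempty (- z).
exists (- t0) => t /= Ct; rewrite leNgt; apply/negP => tt0.
apply: opp_order_unit_notin.
have tt0' : 0 < - (t + t0) by lra.
have -> : - e = (- (t + t0))^-1 *: ((t *: e - z) + (t0 *: e - - z)).
  rewrite opprK addrACA addNr addr0 -scalerDl.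
  by rewrite -{2}[t + t0]opprK scaleNr scalerN scalerK ?lt0r_neq0.
by apply: CZ; [rewrite invr_ge0 ltW|exact: CD].
Qed.

Lemma gerstewitz_le t z : C (t *: e - z) -> gerstewitz z <= t.
Proof. by move=> Ct; apply: ge_inf => //; exact: gerstewitz_lbound. Qed.

Lemma gerstewitz_sublinear : sublinear gerstewitz.
Proof.
split=> [u v|t v t0].
- apply: inf_leD; [exact: gerstewitz_nonempty..|exact: gerstewitz_lbound|].
  move=> a b /= Ca Cb; exists (a + b) => //=.
  by rewrite scalerDl opprD addrACA; exact: CD.
- apply: inf_leM => //; [exact: gerstewitz_nonempty|exact: gerstewitz_lbound|].
  move=> a /= Ca; exists (t * a) => //=.
  by rewrite -scalerA -scalerBr; apply: CZ => //; exact: ltW.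
Qed.

Lemma gerstewitz_opp_le0 c : C c -> gerstewitz (- c) <= 0.
Proof. by move=> Cc; apply: gerstewitz_le; rewrite scale0r sub0r opprK. Qed.

Lemma gerstewitz_opp_lt0 c : interior C c -> gerstewitz (- c) < 0.
Proof.
move=> /(interior_absorbing e)[d d0 Cd].
apply: (@le_lt_trans _ _ (- d)); last by rewrite oppr_lt0.
by apply: gerstewitz_le; rewrite opprK addrC scaleNr.
Qed.

Lemma gerstewitz_mono z1 z2 : cone_le C z1 z2 -> gerstewitz z1 <= gerstewitz z2.
Proof.
move=> /gerstewitz_opp_le0; rewrite opprB.
by have := gerstewitz_sublinear.1 z2 (z1 - z2); rewrite addrC subrK; lra.
Qed.

(** For [z] near [z0] the vector [e - (2 / eps) *: (z - z0)] stays in [C]; rescaling it by [eps / 2]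
    bounds the value by [eps / 2], strictly below [eps]. *)
Lemma gerstewitz_nbhs (z0 : Z) (eps : R) : 0 < eps ->
  nbhs z0 [set z | gerstewitz (z - z0) < eps].
Proof.
move=> eps0.
have cont : (fun z : Z => e - (2 / eps) *: (z - z0)) @ z0 --> e.
  rewrite -[X in _ --> X]subr0 -(scaler0 _ (2 / eps)) -(subrr z0).
  apply: tvs_cvgB; first exact: cvg_cst.
  apply: tvs_cvgZ; first exact: cvg_cst.
  by apply: tvs_cvgB; [exact: cvg_id|exact: cvg_cst].
have : nbhs z0 [set z | C (e - (2 / eps) *: (z - z0))] := cont _ e_int.
apply: filterS => z /= Cz.
apply: (@le_lt_trans _ _ (eps / 2)); last by lra.
apply: gerstewitz_le.
have -> : (eps / 2) *: e - (z - z0) = (eps / 2) *: (e - (2 / eps) *: (z - z0)).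
  rewrite [RHS]scalerBr scalerA -[eps / 2]invf_div mulVf ?scale1r//.
  by rewrite lt0r_neq0// divr_gt0.
by apply: CZ => //; rewrite divr_ge0// ltW.
Qed.

Lemma gerstewitz_usc (X : topologicalType) (K : set X) (g : X -> Z) x (eps : R) :
  cone_usc_at C K g x -> 0 < eps ->
  \forall u \near x, K u -> gerstewitz (g u) < gerstewitz (g x) + eps.
Proof.
move=> gusc eps0; have [U xU UP] := gusc _ (gerstewitz_nbhs (g x) eps0).
apply: filterS xU => u Uu Ku; have [v /= gv [c Cc guE]] := UP _ (conj Uu Ku).
have := gerstewitz_mono (_ : cone_le C (g u) v).
rewrite /cone_le -guE opprB addrC subrK => /(_ Cc).
by have := gerstewitz_sublinear.1 (v - g x) (g x); rewrite subrK; lra.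
Qed.

(** Writing [- g u = v - c] with [v] near [- g x] gives [g x = (v + g x) + (g u - c)]; subadditivity
    bounds the first term by [eps] and monotonicity the second by the value at [g u]. *)
Lemma gerstewitz_lsc (X : topologicalType) (K : set X) (g : X -> Z) x (eps : R) :
  cone_lsc_at C K g x -> 0 < eps ->
  \forall u \near x, K u -> gerstewitz (g x) < gerstewitz (g u) + eps.
Proof.
move=> glsc eps0; have [U xU UP] := glsc _ (gerstewitz_nbhs (- g x) eps0).
apply: filterS xU => u Uu Ku; have [v /= gv [c Cc guE]] := UP _ (conj Uu Ku).
have := gerstewitz_mono (_ : cone_le C (g u - c) (g u)).
rewrite /cone_le opprB addrC subrK => /(_ Cc).
have := gerstewitz_sublinear.1 (v - - g x) (g u - c).
have -> : v - - g x + (g u - c) = g x.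
  by rewrite -[g u]opprK -guE opprB opprK (addrAC c) subrr sub0r addrAC subrr add0r.
by lra.
Qed.

Lemma gerstewitz_ltD z1 z2 : opp_set (interior C) (z1 - z2) ->
  gerstewitz z1 < gerstewitz z2.
Proof.
move=> [c /gerstewitz_opp_lt0 + cE]; rewrite cE.
by have := gerstewitz_sublinear.1 (z1 - z2) z2; rewrite subrK; lra.
Qed.

End gerstewitz.

(** Since [y0] is in the open ball, a short step from it towards [y] stays in the ball. There [h] is
    at least [h x0], while convexity bounds it by a mean of [h y0 <= h x0] and [h y], with positive
    weight on [h y]. *)
Lemma convex_ball_min_global (R : realType) (X : normedModType R) (K : set X)
    (h : X -> R) (r : R) (x0 y0 : X) :
  convex_set (K : set (convex_lmodType X)) ->
  (forall x y t, K x -> K y -> 0 <= t -> t <= 1 ->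
    h (x + t *: (y - x)) <= h x + t * (h y - h x)) ->
  (forall y, K y -> `|y| <= r -> h x0 <= h y) ->
  K y0 -> `|y0| < r -> h y0 <= h x0 ->
  forall y, K y -> h x0 <= h y.
Proof.
move=> /convex_setP Kcvx hcvx hmin Ky0 y0r hy0 y Ky.
have c0 : 0 < `|y - y0| + 1 by rewrite ltr_wpDl.
(* The step has length at most [r - |y0|]; the 1 in the denominator covers [y = y0]. *)
pose t := Num.min 1 ((r - `|y0|) / (`|y - y0| + 1)).
have t0 : 0 < t by rewrite lt_min ltr01 divr_gt0// subr_gt0.
have t1 : t <= 1 by rewrite ge_min lexx.
have : t <= (r - `|y0|) / (`|y - y0| + 1) by rewrite ge_min lexx orbT.
rewrite ler_pdivlMr// => tr.
have := hmin _ (Kcvx _ _ _ Ky0 Ky (ltW t0) t1).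
have : `|y0 + t *: (y - y0)| <= r.
  have := ler_normD y0 (t *: (y - y0)); rewrite normrZ gtr0_norm//.
  by have := normr_ge0 (y - y0); lra.
move=> -> /(_ isT) h0; have := hcvx _ _ _ Ky0 Ky (ltW t0) t1.
by nra.
Qed.

Lemma cone_convex_on2 (R : realType) (X Z : lmodType R) (C : set Z) (D : set X)
    (F : X -> Z) (x y : X) (t : R) :
  cone_convex_on C D F -> D x -> D y -> 0 <= t -> t <= 1 ->
  D (x + t *: (y - x)) ->
  cone_le C (F (x + t *: (y - x))) ((1 - t) *: F x + t *: F y).
Proof.
move=> FD Dx Dy t0 t1.
have := FD 2 (fun i => if i == ord0 then x else y)
  (fun i => if i == ord0 then 1 - t else t).
rewrite !big_ord_recl !big_ord0 /= !addr0 subrK segment_combE; apply=> //.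
- by move=> i; case: ifP.
- by move=> i; case: ifP => // _; rewrite subr_ge0.
Qed.

(** In the zero space [- interior C] contains 0 and no point could be weakly efficient, which
    [Z_nontrivial] excludes. The point of [K] in the ball keeps the coercivity condition from
    holding vacuously. *)
Theorem theorem5p1 (R : realType) (X : completeNormedModType R)
  (Z : tvsType R) (C : set Z) (K D : set X) (F : X -> Z)
  (X_reflexive : reflexive_space X)
  (Z_hausdorff : hausdorff_space Z)
  (Z_nontrivial : exists z : Z, z <> 0)
  (C_convex : convex_cone C)
  (C_pointed : pointed_cone C)
  (C_solid : interior C !=set0)
  (K_nonempty : K !=set0)
  (K_convex : convex_set (K : set (convex_lmodType X)))
  (K_closed : closed K)
  (D_sub : D `<=` K)
  (D_dense : self_segment_dense (@weak_closure R X) D K)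
  (F_lsc : forall x, K x -> cone_lsc_at C K F x)
  (F_usc : forall x, (K `\` D) x -> cone_usc_at C K F x)
  (F_convex : cone_convex_on C D F)
  (F_coercive : exists r : R, [/\ 0 < r,
     (exists x, K x /\ `|x| <= r) &
     forall x, K x -> `|x| <= r ->
       exists y0, [/\ D y0, `|y0| < r &
         (opp_set (interior C) `|` [set 0]) (F y0 - F x)]]) :
  exists x0, weakly_efficient C K F x0.
Proof.
have [e eint] := C_solid.
pose h x := gerstewitz C e (F x).
have sub := gerstewitz_sublinear Z_nontrivial C_convex C_pointed eint.
have hlsc x : K x -> forall eps, 0 < eps -> \forall u \near x, K u -> h x < h u + eps.
  move=> Kx eps eps0; exact: gerstewitz_lsc (F_lsc _ Kx) eps0.
have hcvx : forall x y t, K x -> K y -> 0 <= t -> t <= 1 ->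
    h (x + t *: (y - x)) <= h x + t * (h y - h x).
  apply: convex_of_convex_on_dense D_sub K_convex D_dense hlsc _ _.
    move=> x KDx eps eps0; exact: gerstewitz_usc (F_usc _ KDx) eps0.
  move=> x y t Dx Dy t0 t1 Dxy.
  have t1' : 0 <= 1 - t by rewrite subr_ge0.
  have := gerstewitz_mono Z_nontrivial C_convex C_pointed eint
    (cone_convex_on2 F_convex Dx Dy t0 t1 Dxy).
  have := sub.1 ((1 - t) *: F x) (t *: F y).
  by rewrite !(sublinearZ _ sub)// -/(h _) -/(h x) -/(h y); lra.
have [r [r0 Kr Fr]] := F_coercive.
have [x0 [Kx0 x0r hx0]] := reflexive_exists_min X_reflexive K_convex K_closed hlsc hcvx Kr.
have [y0 [Dy0 y0r Fy0]] := Fr _ Kx0 x0r.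
have hlt x y : opp_set (interior C) (F y - F x) -> h y < h x.
  exact: gerstewitz_ltD.
(* The two alternatives of coercivity give a strict decrease of [h] or equal values of [F]. *)
have hy0 : h y0 <= h x0.
  by case: Fy0 => [/hlt/ltW//|/= /subr0_eq]; rewrite /h => ->.
(* A violation of weak efficiency at [y] would make [h y < h x0], against global minimality. *)
exists x0; split=> // y Ky /hlt; apply/negP; rewrite -leNgt.
exact: convex_ball_min_global K_convex hcvx hx0 (D_sub _ Dy0) y0r hy0 _ Ky.
Qed.
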